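(* Let $K \subseteq \mathbb{R}^n$ be a non-empty compact convex set. Then the Chvátal-Gomory closure $\mathrm{CC}(K)$ is finitely generated, i.e. there exists $S \subseteq \mathbb{Z}^n$ with $|S| < \infty$ and $\mathrm{CC}(K) = \mathrm{CC}(K,S)$. In particular, $\mathrm{CC}(K)$ is a rational polyhedron.
   Context: For a convex set $K \subseteq \mathbb{R}^n$, the support function is $h_K(a) = \sup\{\langle a, x\rangle : x \in K\}$ for $a \in \mathbb{R}^n$. For $S \subseteq \mathbb{Z}^n$ define $\mathrm{CC}(K,S) = \bigcap_{a \in S} \{x \in \mathbb{R}^n : \langle a, x\rangle \le \lfloor h_K(a) \rfloor\}$, and define the Chvátal-Gomory (CG) closure of $K$ as $\mathrm{CC}(K) = \mathrm{CC}(K, \mathbb{Z}^n)$. *)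

(* Defs.v *)
From mathcomp Require Import all_boot all_order all_algebra.
From mathcomp Require Import all_classical all_reals all_analysis.
Set Implicit Arguments.
Unset Strict Implicit.
Unset Printing Implicit Defensive.
Import Order.TTheory GRing.Theory Num.Theory.
Import numFieldNormedType.Exports.

Local Open Scope classical_set_scope.
Local Open Scope ring_scope.

Definition dotp (R : pzRingType) (n : nat) (u v : 'rV[R]_n) : R :=
  \sum_(i < n) u 0 i * v 0 i.

(* Extended-real valued: +oo when K is unbounded in direction a, -oo when K is
   empty. *)
Definition support_fun (R : realType) (n : nat) (K : set 'rV[R]_n)
    (a : 'rV[R]_n) : \bar R :=
  ereal_sup [set (dotp a x)%:E | x in K].

(* The floor fixes -oo and +oo, so a direction in which K is unbounded imposes
   no constraint. *)
Definition floore (R : realType) (h : \bar R) : \bar R :=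
  er_map (fun r : R => (Num.floor r)%:~R) h.

Definition int_vec (R : realType) (n : nat) (a : 'rV[int]_n) : 'rV[R]_n :=
  map_mx intr a.

Definition CG_cuts (R : realType) (n : nat) (K : set 'rV[R]_n)
    (S : set 'rV[int]_n) : set 'rV[R]_n :=
  \bigcap_(a in S)
    [set x | ((dotp (int_vec R a) x)%:E <= floore (support_fun K (int_vec R a)))%E].

Definition CG_closure (R : realType) (n : nat) (K : set 'rV[R]_n) :
    set 'rV[R]_n :=
  CG_cuts K [set: 'rV[int]_n].

Definition rational_polyhedron (R : realType) (n : nat) (P : set 'rV[R]_n) :
    Prop :=
  exists (m : nat) (A : 'M[rat]_(m, n)) (b : 'rV[rat]_m),
    P = [set x | forall i : 'I_m,
                   dotp (map_mx ratr (row i A)) x <= ratr (b 0 i)].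

(* Main.v *)
Require Import Defs.
From mathcomp Require Import all_boot all_order all_algebra.
From mathcomp Require Import all_classical all_reals all_analysis.
From mathcomp Require Import finmap ring lra zify.
Import Order.TTheory GRing.Theory Num.Theory.
Import numFieldNormedType.Exports.

Local Open Scope classical_set_scope.
Local Open Scope ring_scope.
Set Implicit Arguments.
Unset Strict Implicit.

(** Write h for the support function of K and homogenise: on vectors (b, a) of
    dimension 1 + n the function g(b, a) = h(a) - b is sublinear, and an integer
    b satisfies floor (h a) <= b exactly when g(b, a) < 1.  So the
    Chvatal-Gomory cuts, together with their weakenings, are the integer vectors
    z with g z < 1 ([cut_vectors]).  It suffices to find finitely many of them
    of which every other one is a nonnegative combination: the finitely many
    corresponding cuts then imply all cuts.  This is
    [cut_vectors_finitely_generated], which holds for every sublinear g; it is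
    proved with a linear bound on the total weight of the combination, which
    is what makes the induction go through.

    The proof is an induction on the codimension of a subspace U on which g is
    known to be at most 0.  There are finitely many short integer vectors; so, by
    compactness of the unit sphere, only long cut vectors z whose direction is
    close to a given w matter.  If g w > 0 there are none.  If g w <= 0,
    Dirichlet's theorem gives integer vectors arbitrarily far along the ray of w
    and arbitrarily close to it; those close enough are cut vectors.  The space V that
    they span, however close they are required to be ([ray_span]), contains w,
    and w is in the interior, relative to V, of a cone generated by finitely
    many of them ([ray_span_interior]): if Z is much closer to the ray than
    z1, then Z - z1 is again close to the ray, with nearly opposite error.
    Write z = Z + a with Z an integer vector of V close to |z| w and a short.

    - If V lies in U, then a = z - Z is a cut vector at most half as long as z,
      and Z lies in that cone; so one can recurse on the length.
    - Otherwise let phi x be the infimum of g (x + v) over v in V; geometrically,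
      the convex set with support function g is cut down to its intersection
      with the orthogonal complement of V.  If phi is finite, it is
      sublinear, at most 0 on U + V, and below 1 at a; by induction, a is a
      combination of finitely many c with phi c < 1.  If phi is not finite,
      the unit vectors and their opposites serve as the c.
      In both cases each c becomes a cut vector of g after adding a suitable
      integer vector of V ([sublinear_lift], where simultaneous
      approximation is used a second time).  The correction, Z minus those
      additions, stays in V and close to |z| w, hence in the cone above
      ([locally_generated_mod]). *)

(** * Integer vectors and simultaneous approximation *)

Lemma coord_le_norm (R : realType) (d : nat) (x : 'rV[R]_d) (i : 'I_d) :
  `|x 0 i| <= `|x|.
Proof.
rewrite [leRHS]/Num.norm /= mx_normrE.
by apply/bigmax_geP; right; exists (0, i).
Qed.

Lemma norm_le_coord (R : realType) (d : nat) (x : 'rV[R]_d) (c : R) :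
  0 <= c -> (forall i, `|x 0 i| <= c) -> `|x| <= c.
Proof.
move=> c0 xc; rewrite [leLHS]/Num.norm /= mx_normrE; apply/bigmax_leP.
by split=> // -[j i] _ /=; rewrite ord1.
Qed.

Lemma norm_lt_coord (R : realType) (d : nat) (x : 'rV[R]_d) (c : R) :
  0 < c -> (forall i, `|x 0 i| < c) -> `|x| < c.
Proof.
move=> c0 xc; rewrite [ltLHS]/Num.norm /= mx_normrE; apply/bigmax_ltP.
by split=> // -[j i] _ /=; rewrite ord1.
Qed.

Lemma int_vecD (R : realType) (d : nat) (x y : 'rV[int]_d) :
  int_vec R (x + y) = int_vec R x + int_vec R y.
Proof. exact: raddfD. Qed.

Lemma int_vecB (R : realType) (d : nat) (x y : 'rV[int]_d) :
  int_vec R (x - y) = int_vec R x - int_vec R y.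
Proof. exact: raddfB. Qed.

Lemma int_vec0 (R : realType) (d : nat) : int_vec R (0 : 'rV[int]_d) = 0.
Proof. exact: raddf0. Qed.

Lemma int_vecN (R : realType) (d : nat) (x : 'rV[int]_d) :
  int_vec R (- x) = - int_vec R x.
Proof. exact: raddfN. Qed.

Lemma int_vec_sum (R : realType) (d k : nat) (x : 'I_k -> 'rV[int]_d) :
  int_vec R (\sum_i x i) = \sum_i int_vec R (x i).
Proof. exact: (big_morph _ (@int_vecD R d) (int_vec0 R d)). Qed.

Lemma int_vecZ (R : realType) (d : nat) (k : int) (x : 'rV[int]_d) :
  int_vec R (k *: x) = k%:~R *: int_vec R x.
Proof. by apply/rowP => i; rewrite !mxE intrM. Qed.

Lemma int_vec_norm_ge1 (R : realType) (d : nat) (z : 'rV[int]_d) :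
  z != 0 -> 1 <= `|int_vec R z|.
Proof.
move=> z0; have [i zi] : exists i, z 0 i != 0.
  apply: contrapT => nz; move/eqP: z0; apply; apply/rowP => i; rewrite mxE.
  by apply/eqP; apply: contrapT => /negP zi; apply: nz; exists i.
apply: le_trans (coord_le_norm _ i); rewrite mxE -intr_norm -[1]/(1%:~R) ler_int.
by rewrite -gtz0_ge1 normr_gt0.
Qed.

Lemma mulmx_bounded (R : realType) (k d : nat) (B : 'M[R]_(k, d)) :
  exists2 M : R, 0 < M & forall x : 'rV[R]_k, `|x *m B| <= M * `|x|.
Proof.
exists (1 + \sum_i \sum_j `|B i j|).
  by rewrite ltr_wpDr// sumr_ge0// => i _; rewrite sumr_ge0.
move=> x; apply: norm_le_coord => [|j].
  by rewrite mulr_ge0// addr_ge0// sumr_ge0// => i _; rewrite sumr_ge0.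
rewrite mxE (le_trans (ler_norm_sum _ _ _))//.
have -> : (1 + \sum_i \sum_j0 `|B i j0|) * `|x| =
    `|x| + \sum_i `|x| * \sum_j0 `|B i j0|.
  by rewrite mulrDl mul1r mulrC mulr_sumr.
rewrite ler_wpDl//; apply: ler_sum => i _; rewrite normrM.
apply: ler_pM => //; first exact: coord_le_norm.
by rewrite (bigD1 j)//= lerDl sumr_ge0.
Qed.

(** Dirichlet's simultaneous approximation, by the pigeonhole principle on the
    fractional parts of the multiples of w. *)
Lemma dirichlet (R : realType) (d : nat) (w : 'rV[R]_d) (e N : R) :
  0 < e ->
  exists2 t : R, N <= t & exists z : 'rV[int]_d, `|int_vec R z - t *: w| < e.
Proof.
move=> e0.
(* Only multiples of N0 are compared, so that every difference of two of them
   is at least N. *)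
pose m := Num.truncn e^-1; pose N0 := (Num.truncn N).+1.
pose fr (x : R) := x - (Num.floor x)%:~R.
have fr_ge0 x : 0 <= fr x by rewrite subr_ge0; have /andP[] := floor_itv x.
have fr_lt1 x : fr x < 1.
  by rewrite ltrBlDr addrC -intrD1; have /andP[] := floor_itv x.
pose q (j : nat) (i : 'I_d) := Num.truncn (m.+1%:R * fr ((j * N0)%:R * w 0 i)).
have q_lt j i : (q j i < m.+1)%N.
  rewrite truncn_lt_nat ?mulr_ge0//.
  by rewrite -[ltRHS]mulr1 ltr_pM2l.
pose f (j : 'I_(m.+1 ^ d).+1) : {ffun 'I_d -> 'I_m.+1} := [ffun i => Ordinal (q_lt j i)].
have /injectivePn[j [k jk fjk]] : ~~ injectiveb f.
  apply/negP => /injectiveP /leq_card; rewrite card_ffun !card_ord.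
  by rewrite ltnn.
wlog ltjk : j k jk fjk / (j < k)%N.
  move=> wl; have [/wl|/wl|/val_inj e'] := ltngtP j k; first exact.
    by apply; [rewrite eq_sym|].
  by move: jk; rewrite e' eqxx.
exists ((k - j) * N0)%:R.
  have /ltW : N < N0%:R by exact: truncnS_gt.
  move/le_trans; apply; rewrite ler_nat leq_pmull// subn_gt0//.
exists (\row_i (Num.floor ((k * N0)%:R * w 0 i) - Num.floor ((j * N0)%:R * w 0 i))).
apply: norm_lt_coord => // i; rewrite !mxE intrB.
have -> : forall a b, a - b - ((k - j) * N0)%:R * w 0 i =
  (((j * N0)%:R * w 0 i) - b) - (((k * N0)%:R * w 0 i) - a).
  move=> a b; rewrite mulnBl natrB ?leq_mul2r ?(ltnW ltjk) ?orbT//; ring.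
rewrite -!/(fr _).
have : q j i = q k i by have /ffunP/(_ i) := fjk; rewrite !ffunE => -[].
rewrite /q.
set a := fr _; set b := fr _ => qab.
have /andP[a1 a2] : (q j i)%:R <= m.+1%:R * a < (q j i).+1%:R.
  by rewrite truncn_itv// mulr_ge0// fr_ge0.
have /andP[b1 b2] : (q j i)%:R <= m.+1%:R * b < (q j i).+1%:R.
  by rewrite /q qab truncn_itv// mulr_ge0// fr_ge0.
have m1 : e^-1 < m.+1%:R.
  exact: truncnS_gt.
have me : 1 < e * m.+1%:R by rewrite mulrC -ltr_pdivrMr// div1r.
have : `|m.+1%:R * (a - b)| < 1.
  rewrite mulrBr ltr_norml; rewrite -natr1 in a2 b2; lra.
rewrite normrM ger0_norm// => /lt_trans /(_ me).
by rewrite mulrC ltr_pM2r.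
Qed.

(** * Nonnegative combinations of integer vectors *)

(** [cone S x s]: x is a nonnegative combination of S of total weight at most s.
    The inductive form composes combinations over changing generating sets
    without any bookkeeping of coefficients. *)
Inductive cone (R : realType) (d : nat) (S : set 'rV[int]_d) :
    'rV[R]_d -> R -> Prop :=
  | Cone0 s of 0 <= s : cone S 0 s
  | ConeS c l x s of S c & 0 <= l & cone S x s :
      cone S (l *: int_vec R c + x) (l + s).

Section ConeTheory.
Variables (R : realType) (d : nat).
Implicit Types (S T : set 'rV[int]_d) (x y v : 'rV[R]_d) (s t : R).

Lemma cone_weaken S x s t : cone S x s -> s <= t -> cone S x t.
Proof.
move=> Sx; elim: Sx t => [{}s s0 t st|c l {}x {}s Sc l0 _ IH t st].
  by apply: Cone0; exact: le_trans st.
have -> : t = l + (t - l) by ring.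
by apply: ConeS => //; apply: IH; rewrite lerBrDl.
Qed.

Lemma cone_sub S T x s : S `<=` T -> cone S x s -> cone T x s.
Proof.
move=> ST; elim=> [{}s|c l {}x {}s Sc l0 _]; first exact: Cone0.
by apply: ConeS => //; exact: ST.
Qed.

Lemma coneD S x s y t : cone S x s -> cone S y t -> cone S (x + y) (s + t).
Proof.
move=> Sx Sy; elim: Sx => [{}s s0|c l {}x {}s Sc l0 _ IH].
  by rewrite add0r; apply: cone_weaken Sy _; rewrite lerDr.
by rewrite -!addrA; exact: ConeS.
Qed.

Lemma coneZ S k x s : 0 <= k -> cone S x s -> cone S (k *: x) (k * s).
Proof.
move=> k0; elim=> [{}s s0|c l {}x {}s Sc l0 _ IH].
  by rewrite scaler0; apply: Cone0; rewrite mulr_ge0.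
by rewrite scalerDr scalerA mulrDr; apply: ConeS => //; rewrite mulr_ge0.
Qed.

Lemma cone_gen S c : S c -> cone S (int_vec R c) 1.
Proof.
move=> Sc; have := ConeS Sc ler01 (@Cone0 R d S 0 (lexx 0)).
by rewrite scale1r !addr0.
Qed.

Lemma coneZ_gen S k c : 0 <= k -> S c -> cone S (k *: int_vec R c) k.
Proof.
by move=> k0 Sc; have := coneZ k0 (cone_gen Sc); rewrite mulr1.
Qed.

Lemma cone_sum S k (x : 'I_k -> 'rV[R]_d) (s : 'I_k -> R) :
  (forall i, cone S (x i) (s i)) -> cone S (\sum_i x i) (\sum_i s i).
Proof.
move=> Sx; elim/big_ind2 : _ => //; first exact: Cone0.
by move=> *; exact: coneD.
Qed.

(** Replacing each generator c by c + z with z in V changes the represented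
    vector by an element of V whose size is controlled by the weight. *)
Lemma cone_shift m (V : 'M[R]_(m, d)) S T (B : R) x s :
  0 <= B -> (forall c, T c -> exists z, [/\ (int_vec R z <= V)%MS,
     `|int_vec R z| <= B & S (c + z)]) ->
  cone T x s -> exists v, [/\ (v <= V)%MS, `|v| <= B * s & cone S (x + v) s].
Proof.
move=> B0 TS; elim=> [{}s s0|c l {}x {}s /TS[z [zV zB Scz]] l0 Tx [v [vV vB Sxv]]].
  exists 0; split; [exact: sub0mx| |by rewrite addr0; exact: Cone0].
  by rewrite normr0 mulr_ge0.
exists (l *: int_vec R z + v); split.
- by rewrite addmx_sub// scalemx_sub.
- rewrite mulrDr (le_trans (ler_normD _ _))// lerD// normrZ ger0_norm//.
  by rewrite mulrC ler_wpM2r.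
- by rewrite addrACA -scalerDr -int_vecD; exact: ConeS.
Qed.
End ConeTheory.

(** * Integer vectors near a ray *)

Definition near_ray (R : realType) (d : nat) (w : 'rV[R]_d) (e : R)
    (z : 'rV[int]_d) :=
  exists2 t : R, e^-1 <= t & `|int_vec R z - t *: w| < e.

Lemma near_rayW (R : realType) (d : nat) (w : 'rV[R]_d) (e e' : R)
    (z : 'rV[int]_d) :
  0 < e -> e <= e' -> near_ray w e z -> near_ray w e' z.
Proof.
move=> e0 ee' [t et zt]; exists t; last exact: lt_le_trans ee'.
by apply: le_trans et; rewrite lef_pV2// posrE (lt_le_trans e0).
Qed.

Lemma near_ray_exists (R : realType) (d : nat) (w : 'rV[R]_d) (e : R) :
  0 < e -> exists z, near_ray w e z.
Proof.
by move=> e0; have [t et [z zt]] := dirichlet w e^-1 e0; exists z, t.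
Qed.

Lemma near_ray_times (R : realType) (d m : nat) (w : 'rV[R]_d) (e : R)
    (A : 'M[int]_(m, d)) :
  0 < e -> (forall i, near_ray w e (row i A)) ->
  exists2 t : 'I_m -> R, (forall i, 0 <= t i) &
    forall i, `|int_vec R (row i A) - t i *: w| < e.
Proof.
move=> e_gt0 nA; have /choice[t tP] : forall i, exists t,
    e^-1 <= t /\ `|int_vec R (row i A) - t *: w| < e.
  by move=> i; have [t] := nA i; exists t.
exists t => i; have [et ti] := tP i; last exact: ti.
by apply: le_trans et; rewrite invr_ge0 ltW.
Qed.

Lemma int_rows_coordinates (R : realType) (d m : nat) (A : 'M[int]_(m, d))
    (v : 'rV[R]_d) : (v <= (map_mx intr A : 'M[R]_(_, _)))%MS ->
  v = \sum_i (v *m pinvmx (map_mx intr A)) 0 i *: int_vec R (row i A).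
Proof.
move=> vA; rewrite -[LHS](mulmxKpV vA) mulmx_sum_row.
by apply: eq_bigr => i _; rewrite -map_row.
Qed.

(** A matrix whose row space is the span of the integer vectors near the ray of w,
    for all sufficiently strict notions of nearness at once.  That the number of rows of A does not grow as e decreases is used to
    bound rounding errors. *)
Definition ray_span (R : realType) (d : nat) (w : 'rV[R]_d) (m : nat)
    (V : 'M[R]_(m, d)) :=
  [/\ (w <= V)%MS,
      (exists2 e, 0 < e & forall z, near_ray w e z -> (int_vec R z <= V)%MS) &
      (forall e, 0 < e -> exists2 A : 'M[int]_(m, d),
        (forall i, near_ray w e (row i A)) & (V <= (map_mx intr A : 'M[R]_(_, _)))%MS)].

(** The rank of the integer vectors near the ray decreases with e, so it is
    eventually constant, equal to some r, and the span itself is then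
    constant.  It contains w because a subspace is closed. *)
Lemma ray_span_exists (R : realType) (d : nat) (w : 'rV[R]_d) :
  exists m (V : 'M[R]_(m, d)), ray_span w V.
Proof.
(* Q r: near vectors of some precision have rank at most r. *)
pose Q r := exists2 e : R, 0 < e & forall A : 'M[int]_(r.+1, d),
  (forall i, near_ray w e (row i A)) -> ~~ row_free (map_mx intr A : 'M[R]_(_, _)).
have exQ : exists r, `[< Q r >].
  exists d; apply/asboolP; exists 1 => // A _.
  by rewrite -row_leq_rank -ltnNge ltnS rank_leq_col.
case: (ex_minnP exQ) => r /asboolP[e0 e0_gt0 maxr] minr.
have base e : 0 < e -> exists2 A : 'M[int]_(r, d),
    (forall i, near_ray w e (row i A)) & row_free (map_mx intr A : 'M[R]_(_, _)).
  move=> e_gt0; case: r minr {maxr} => [|r] minr.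
    exists 0 => [[]//|]; by rewrite -row_leq_rank.
  have /negP nQ : ~~ `[< Q r >] by apply/negP => /minr; rewrite ltnn.
  apply: contrapT => noA; apply: nQ; apply/asboolP; exists e => // A nA.
  by apply/negP => Af; apply: noA; exists A.
have [A0 nA0 freeA0] := base e0 e0_gt0.
pose V : 'M[R]_(r, d) := map_mx intr A0.
have near_sub z : near_ray w e0 z -> (int_vec R z <= V)%MS.
  move=> nz; apply/negPn/negP => zV.
  have /maxr/negP :
      forall i, near_ray w e0 (row i (col_mx z A0 : 'M[int]_(1 + r, d))).
    move=> i; case: (split_ordP i) => j ->.
      by rewrite (_ : row _ _ = z)//; apply/rowP => k; rewrite mxE col_mxEu ord1.
    rewrite (_ : row _ _ = row j A0)//; apply/rowP => k.
    by rewrite mxE col_mxEd mxE.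
  apply; rewrite -row_leq_rank.
  have -> : map_mx intr (col_mx z A0) = col_mx (int_vec R z) V :> 'M[R]_(1 + r, d).
    exact: map_col_mx.
  have : (V < int_vec R z + V)%MS.
    by rewrite ltmxE addsmxSr /= addsmx_sub (negbTE zV).
  by move/rank_ltmx; rewrite (eqP (freeA0 : \rank V == r)) addsmxE.
exists r, V; split; last 2 first.
- by exists e0.
- move=> e e_gt0; have m0 : 0 < Num.min e e0 by rewrite lt_min e_gt0.
  have [A nA freeA] := base _ m0; exists A.
    by move=> i; apply: near_rayW (nA i) => //; rewrite ge_min lexx.
  have AV : (map_mx intr A <= V)%MS.
    apply/row_subP => i; rewrite -map_row; apply: near_sub.
    by apply: near_rayW (nA i) => //; rewrite ge_min lexx orbT.
  rewrite -(mxrank_leqif_sup AV) (eqP (freeA0 : \rank V == r)).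
  by rewrite (eqP (freeA : \rank _ == r)).
- rewrite submxE; apply/negPn/negP; rewrite -normr_gt0.
  set C := cokermx V; set p := `|_| => p0.
  have [M M0 MC] := mulmx_bounded C.
  pose e := Num.min e0 (Num.min 1 (p / (2 * M))).
  have e_gt0 : 0 < e by rewrite !lt_min e0_gt0 ltr01 divr_gt0// mulr_gt0.
  have [z nz] := near_ray_exists w e_gt0.
  have zC : int_vec R z *m C = 0.
    apply/eqP; rewrite -submxE; apply: near_sub.
    by apply: near_rayW nz => //; rewrite ge_min lexx.
  have [t et zt] := nz.
  have t1 : 1 <= t.
    apply: le_trans et; rewrite invf_ge1//.
    by rewrite !ge_min lexx orbT.
  have := MC (int_vec R z - t *: w).
  rewrite mulmxBl zC sub0r normrN -scalemxAl normrZ ger0_norm ?(le_trans _ t1)//.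
  rewrite -/p => h.
  have : t * p < p.
    apply: le_lt_trans h _; apply: (@lt_trans _ _ (M * e)); first by rewrite ltr_pM2l.
    apply: (@le_lt_trans _ _ (M * (p / (2 * M)))).
      by rewrite ler_wpM2l ?(ltW M0)// !ge_min lexx !orbT.
    rewrite (_ : M * _ = p / 2); first by lra.
    by field; rewrite gt_eqF.
  by apply/negP; rewrite -leNgt ler_peMl// ltW.
Qed.

Section RaySpan.
Variables (R : realType) (d m : nat) (w : 'rV[R]_d) (V : 'M[R]_(m, d)).
Hypothesis spanV : ray_span w V.

(** The ray of w is interior, relative to V, to a cone generated by finitely many
    near integer vectors.  Let the rows z_i span V and let Z be near the
    ray at time T, with a much smaller error than the z_i.  For v close to
    s w, the vector T v - s Z is a combination of the z_i with coefficients
    beta_i, at most b s in absolute value; so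
    T v = b s Z + sum_i (beta_i + b s) z_i + sum_i b s (Z - z_i), as m b = 1 - b.
    The coefficients are nonnegative, and each Z - z_i is near the ray because
    the error of z_i may be negated. *)
Lemma ray_span_interior (e : R) : 0 < e ->
  exists S : set 'rV[int]_d, exists delta C : R,
  [/\ finite_set S, S `<=` near_ray w e, 0 < delta, 0 <= C &
      forall v s, 0 <= s -> (v <= V)%MS -> `|v - s *: w| <= delta * s ->
        cone S v (C * s)].
Proof.
have [_ [e0 e0_gt0 nearV] basisV] := spanV => e_gt0.
(* The rows of A get half of the allowed error, which leaves the other half for
   Z in the differences Z - z_i. *)
pose e2 := Num.min e e0; pose e1 := e2 / 2.
have e2_gt0 : 0 < e2 by rewrite lt_min e_gt0.
have e1_gt0 : 0 < e1 by rewrite divr_gt0.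
have e12 : e1 + e1 = e2 by rewrite /e1; lra.
have nearV2 z : near_ray w e2 z -> (int_vec R z <= V)%MS.
  by move=> nz; apply/nearV/(near_rayW e2_gt0 _ nz); rewrite ge_min lexx orbT.
have [A nA VA] := basisV e1 e1_gt0.
have [t t_ge0 tP] := near_ray_times e1_gt0 nA.
have [M M_gt0 MP] := mulmx_bounded (pinvmx (map_mx intr A : 'M[R]_(m, d))).
pose b : R := m.+1%:R^-1.
have b_gt0 : 0 < b by rewrite invr_gt0 ltr0n.
have mb : m%:R * b = 1 - b.
  by rewrite /b -natr1; field; rewrite natr1 pnatr_eq0.
pose dl := Num.min e1 (b / (2 * M)).
have dl_gt0 : 0 < dl by rewrite lt_min e1_gt0 divr_gt0// mulr_gt0.
have [T T_ge [Z ZT]] := dirichlet w (e2^-1 + \sum_i t i + 1) dl_gt0.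
have sum_t_ge0 : 0 <= \sum_i t i by rewrite sumr_ge0.
have e2V_gt0 : 0 < e2^-1 by rewrite invr_gt0.
have T_gt0 : 0 < T by lra.
have Znear : near_ray w e2 Z.
  exists T; first by lra.
  by apply: (lt_le_trans ZT); rewrite ge_min -e12 lerDr ltW.
have ZBnear i : near_ray w e2 (Z - row i A).
  exists (T - t i).
    have : t i <= \sum_i t i by rewrite (bigD1 i)//= lerDl sumr_ge0.
    lra.
  have -> : int_vec R (Z - row i A) - (T - t i) *: w =
      (int_vec R Z - T *: w) - (int_vec R (row i A) - t i *: w).
    by rewrite int_vecB; apply/rowP => k; rewrite !mxE; ring.
  rewrite (le_lt_trans (ler_normB _ _))// -e12 ltrD//.
  by apply: (lt_le_trans ZT); rewrite ge_min lexx.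
pose S := [set Z] `|` range (fun i => row i A) `|` range (fun i => Z - row i A).
have Snear : S `<=` near_ray w e2.
  move=> _ [[->//|[i _ <-]]|[i _ <-]]; last exact: ZBnear.
  by apply: (near_rayW e1_gt0 _ (nA i)); rewrite -e12 lerDr ltW.
exists S, (b / (2 * M) / T), (3 / T); split.
- by rewrite /S !finite_setU; split; [split|]; [exact: finite_set1| |];
     apply: finite_image; exact: finite_finset.
- by move=> z /Snear /(near_rayW e2_gt0); apply; rewrite ge_min lexx.
- by rewrite !divr_gt0// mulr_gt0.
- by rewrite divr_ge0// ltW.
move=> v s s_ge0 vV vw.
pose u := T *: v - s *: int_vec R Z.
have uV : (u <= V)%MS.
  by rewrite addmx_sub// ?eqmx_opp scalemx_sub// nearV2.
pose beta := u *m pinvmx (map_mx intr A : 'M[R]_(m, d)).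
have uE : u = \sum_i beta 0 i *: int_vec R (row i A).
  exact: int_rows_coordinates (submx_trans uV VA).
have beta_le i : `|beta 0 i| <= b * s.
  apply: le_trans (coord_le_norm _ i) _; apply: le_trans (MP _) _.
  have : `|u| <= b / (2 * M) * s + b / (2 * M) * s.
    have -> : u = T *: (v - s *: w) - s *: (int_vec R Z - T *: w).
      by rewrite !scalerBr !scalerA [s * T]mulrC opprB addrA subrK.
    rewrite (le_trans (ler_normB _ _))// lerD// normrZ.
      rewrite gtr0_norm//.
      by apply: le_trans (ler_wpM2l (ltW T_gt0) vw) _; rewrite mulrCA mulrA divfK ?gt_eqF.
    rewrite ger0_norm// mulrC ler_wpM2r// (le_trans (ltW ZT))//.
    by rewrite ge_min lexx orbT.
  move=> /(ler_wpM2l (ltW M_gt0)) /le_trans; apply.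
  by rewrite le_eqVlt; apply/orP; left; apply/eqP; field; rewrite gt_eqF.
suff : cone S (T *: v) (3 * s).
  move/(coneZ (ltW (etrans (invr_gt0 _) T_gt0))).
  by rewrite scalerA mulVf ?gt_eqF// scale1r mulrA [_ * 3]mulrC.
have -> : T *: v = (b * s) *: int_vec R Z
   + (\sum_i (beta 0 i + b * s) *: int_vec R (row i A)
    + \sum_i (b * s) *: int_vec R (Z - row i A)).
  rewrite -big_split /=.
  under eq_bigr do rewrite int_vecB scalerDl scalerBr -addrA [_ + (_ - _)]addrC subrK.
  rewrite big_split /= -uE sumr_const card_ord /u.
  rewrite addrCA scalerMnl -scalerDl.
  have -> : b * s + (b * s) *+ m = s.
    rewrite -mulr_natr mulrAC -[b * m%:R]mulrC mb; ring.
  by rewrite subrK.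
apply: (@cone_weaken _ _ _ _ (b * s + (\sum_(i < m) (2 * b * s) + \sum_(i < m) (b * s)))).
  apply: coneD; last apply: coneD.
  - by apply: coneZ_gen; [rewrite mulr_ge0// ltW|left; left].
  - apply: cone_sum => i; apply: (@cone_weaken _ _ _ _ (beta 0 i + b * s)).
      apply: coneZ_gen; last by left; right; exists i.
      by have := beta_le i; rewrite ler_norml => /andP[]; lra.
    by have := beta_le i; rewrite ler_norml => /andP[_]; lra.
  - apply: cone_sum => i; apply: coneZ_gen; last by right; exists i.
    by rewrite mulr_ge0// ltW.
rewrite !sumr_const card_ord -[(2 * b * s) *+ m]mulr_natl -[(b * s) *+ m]mulr_natl.
have -> : b * s + (m%:R * (2 * b * s) + m%:R * (b * s)) = b * s + 3 * (m%:R * b) * s by ring.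
rewrite mb.
have : 0 <= b * s by rewrite mulr_ge0// ltW.
lra.
Qed.

(** Integer vectors of V are dense in V modulo the ray of w: rounding down the
    coordinates of v in a basis of near vectors changes v by a multiple of w up
    to a small error; adding a vector far along the ray makes that multiple
    nonnegative. *)
Lemma ray_span_approx (v : 'rV[R]_d) (e : R) : (v <= V)%MS -> 0 < e ->
  exists z : 'rV[int]_d, exists2 t : R, 0 <= t &
    (int_vec R z <= V)%MS /\ `|int_vec R z - v - t *: w| < e.
Proof.
have [_ [e0 e0_gt0 nearV] basisV] := spanV => vV e_gt0.
pose e2 := Num.min (e / 2) e0.
have e2_gt0 : 0 < e2 by rewrite lt_min divr_gt0.
have nearV2 z : near_ray w e2 z -> (int_vec R z <= V)%MS.
  by move=> nz; apply/nearV/(near_rayW e2_gt0 _ nz); rewrite ge_min lexx orbT.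
pose e1 := e2 / m.+1%:R.
have e1_gt0 : 0 < e1 by rewrite divr_gt0.
have e1e2 : e1 <= e2 by rewrite ler_pdivrMr// ler_peMr ?(ltW e2_gt0)// ler1n.
have [A nA VA] := basisV e1 e1_gt0.
have [t t_ge0 tP] := near_ray_times e1_gt0 nA.
pose al := v *m pinvmx (map_mx intr A : 'M[R]_(m, d)).
have vE : v = \sum_i al 0 i *: int_vec R (row i A).
  exact: int_rows_coordinates (submx_trans vV VA).
pose fr i := al 0 i - (Num.floor (al 0 i))%:~R.
have fr_ge0 i : 0 <= fr i by rewrite subr_ge0; have /andP[] := floor_itv (al 0 i).
have fr_le1 i : fr i <= 1.
  by rewrite lerBlDr addrC -intrD1; have /andP[_ /ltW] := floor_itv (al 0 i).
pose tau := \sum_i fr i * t i.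
have tau_ge0 : 0 <= tau by rewrite sumr_ge0// => i _; rewrite mulr_ge0.
pose z1 := \sum_i Num.floor (al 0 i) *: row i A.
pose E := \sum_i fr i *: (int_vec R (row i A) - t i *: w).
have z1E : int_vec R z1 = v - tau *: w - E.
  rewrite /z1 int_vec_sum {1}vE /tau scaler_suml /E.
  rewrite -!sumrB; apply: eq_bigr => i _.
  rewrite int_vecZ scalerBr scalerA opprB addrA subrK -scalerBl.
  by rewrite /fr opprB addrC subrK.
have E_le : `|E| <= e2.
  rewrite (le_trans (ler_norm_sum _ _ _))// (@le_trans _ _ (\sum_(i < m) e1))//.
    apply: ler_sum => i _; rewrite normrZ ger0_norm// -[leRHS]mul1r ler_pM//.
    exact/ltW/tP.
  rewrite sumr_const card_ord -[_ *+ _]mulr_natl /e1 mulrCA ler_piMr ?(ltW e2_gt0)//.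
  by rewrite ler_pdivrMr// mul1r ler_nat.
have [T T_ge [Z ZT]] := dirichlet w (e2^-1 + tau) e2_gt0.
have e2V_gt0 : 0 < e2^-1 by rewrite invr_gt0.
exists (z1 + Z), (T - tau); first by lra.
split.
  rewrite int_vecD addmx_sub//; last by apply: nearV2; exists T => //; lra.
  rewrite /z1 int_vec_sum summx_sub// => i _.
  rewrite int_vecZ scalemx_sub// nearV2//.
  exact: near_rayW (nA i).
have -> : int_vec R (z1 + Z) - v - (T - tau) *: w = (int_vec R Z - T *: w) - E.
  rewrite int_vecD z1E scalerBl; apply/rowP => i; rewrite !mxE; ring.
rewrite (le_lt_trans (ler_normB _ _))//.
have : e2 <= e / 2 by rewrite ge_min lexx.
lra.
Qed.

(** Unlike in [ray_span_approx], the position s along the ray is prescribed, and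
    the error is only small relative to s: multiples of a single near vector
    suffice. *)
Lemma ray_span_multiples (eta : R) : 0 < eta ->
  exists2 N : R, 0 < N & forall s, N <= s ->
    exists2 z : 'rV[int]_d, (int_vec R z <= V)%MS & `|int_vec R z - s *: w| <= eta * s.
Proof.
have [_ [e0 e0_gt0 nearV] _] := spanV => eta_gt0.
pose e := Num.min e0 (Num.min (eta / 2) 1).
have e_gt0 : 0 < e by rewrite !lt_min e0_gt0 divr_gt0/=.
have [z0 nz0] := near_ray_exists w e_gt0.
have z0V : (int_vec R z0 <= V)%MS.
  by apply/nearV/(near_rayW e_gt0 _ nz0); rewrite ge_min lexx.
have [T eT z0T] := nz0.
have T_ge1 : 1 <= T.
  by apply: le_trans eT; rewrite invf_ge1// !ge_min lexx !orbT.
have T_gt0 : 0 < T by lra.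
exists (2 * T * `|w| / eta + 1).
  by rewrite ltr_wpDl// divr_ge0 ?(ltW eta_gt0)// !mulr_ge0// ltW.
move=> s Ns.
have s_gt0 : 0 < s.
  by apply: lt_le_trans Ns; rewrite ltr_wpDl// divr_ge0 ?(ltW eta_gt0)// !mulr_ge0// ltW.
pose j := Num.truncn (s / T).
have /andP[j1 j2] : j%:R <= s / T < j.+1%:R.
  by rewrite truncn_itv// divr_ge0// ltW.
have js : j%:R * T <= s by rewrite -ler_pdivlMr.
have sj : s - j%:R * T <= T.
  by rewrite lerBlDr -[X in X + _]mul1r -mulrDl addrC natr1 -ler_pdivrMr// ltW.
exists (j%:Z *: z0); first by rewrite int_vecZ scalemx_sub.
have -> : int_vec R (j%:Z *: z0) - s *: w =
   j%:R *: (int_vec R z0 - T *: w) - (s - j%:R * T) *: w.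
  rewrite int_vecZ -pmulrn scalerBr scalerBl scalerA; apply/rowP => i; rewrite !mxE; ring.
rewrite (le_trans (ler_normB _ _))// !normrZ !ger0_norm ?subr_ge0//.
have h1 : j%:R * `|int_vec R z0 - T *: w| <= eta / 2 * s.
  have -> : eta / 2 * s = s * (eta / 2) by rewrite mulrC.
  apply: ler_pM => //.
    apply: le_trans js; rewrite ler_peMr//.
  by apply: (le_trans (ltW z0T)); rewrite !ge_min lexx !orbT.
have h2 : (s - j%:R * T) * `|w| <= eta / 2 * s.
  apply: le_trans (ler_wpM2r (normr_ge0 w) sj) _.
  have : 2 * T * `|w| / eta <= s by lra.
  rewrite ler_pdivrMr//; lra.
lra.
Qed.
End RaySpan.

(** * Sublinear functions and their quotients *)

Definition sublinear (R : realType) (d : nat) (g : 'rV[R]_d -> R) :=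
  (forall x y, g (x + y) <= g x + g y) /\
  (forall t x, 0 <= t -> g (t *: x) = t * g x).

Definition cut_vectors (R : realType) (d : nat) (g : 'rV[R]_d -> R) :
    set 'rV[int]_d :=
  [set z | g (int_vec R z) < 1].

Section Sublinear.
Variables (R : realType) (d : nat) (g : 'rV[R]_d -> R).
Hypothesis g_sublin : sublinear g.

Lemma sublinear0 : g 0 = 0.
Proof. by have [_ /(_ 0 0 (lexx 0))] := g_sublin; rewrite scaler0 mul0r. Qed.

Lemma sublinear_sum k (x : 'I_k -> 'rV[R]_d) :
  g (\sum_i x i) <= \sum_i g (x i).
Proof.
have [gD _] := g_sublin.
elim/big_ind2 : _ => // [|a b c e ab ce]; first by rewrite sublinear0.
by apply: le_trans (gD _ _) _; rewrite lerD.
Qed.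

Lemma sublinear_bounded : exists2 M : R, 0 < M & forall x, g x <= M * `|x|.
Proof.
have [gD gZ] := g_sublin.
pose B i := `|g (delta_mx 0 i)| + `|g (- delta_mx 0 i)|.
have B0 i : 0 <= B i by rewrite addr_ge0.
exists (1 + \sum_i B i) => [|x]; first by rewrite ltr_wpDr// sumr_ge0.
rewrite {1}(row_sum_delta x) (le_trans (sublinear_sum _))// mulrDl mul1r.
rewrite ler_wpDl// mulr_suml; apply: ler_sum => i _.
apply: (@le_trans _ _ (B i * `|x 0 i|)); last first.
  by rewrite ler_wpM2l// coord_le_norm.
have [x0|/ltW x0] := leP 0 (x 0 i).
  rewrite gZ// mulrC ger0_norm// ler_wpM2r// (le_trans (ler_norm _))//.
  by rewrite lerDl.
rewrite -[x 0 i *: _]opprK -scaleNr -scalerN gZ ?oppr_ge0// mulrC ler0_norm//.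
by rewrite ler_wpM2r ?oppr_ge0// (le_trans (ler_norm _))// lerDr.
Qed.

(** Density lets one replace v by an integer vector z of V up to a multiple t w,
    which does not increase g since t >= 0 and g w <= 0; the strict inequality
    absorbs the remaining error. *)
Lemma sublinear_lift m (w : 'rV[R]_d) (V : 'M[R]_(m, d)) c v :
  ray_span w V -> g w <= 0 -> (v <= V)%MS -> g (c + v) < 1 ->
  exists2 z, (int_vec R z <= V)%MS & g (c + int_vec R z) < 1.
Proof.
move=> spanV gw vV gcv; have [gD gZ] := g_sublin.
have [M M_gt0 gM] := sublinear_bounded.
have e_gt0 : 0 < (1 - g (c + v)) / M by rewrite divr_gt0// subr_gt0.
have [z [t t0 [zV zE]]] := ray_span_approx spanV vV e_gt0.
exists z => //.
have -> : c + int_vec R z = (c + v) + (t *: w + (int_vec R z - v - t *: w)).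
  by apply/rowP => i; rewrite !mxE; ring.
apply: le_lt_trans (gD _ _) _; rewrite -ltrBrDl.
apply: le_lt_trans (gD _ _) _; rewrite gZ//.
apply: le_lt_trans (lerD (mulr_ge0_le0 t0 gw) (gM _)) _.
by rewrite add0r mulrC -ltr_pdivlMr.
Qed.

(** The largest sublinear function below g that is at most 0 on V, provided that
    g >= 0 on V; otherwise the infimum is minus infinity and the value given by
    [inf] is meaningless. *)
Definition quotient_fun m (V : 'M[R]_(m, d)) (x : 'rV[R]_d) : R :=
  inf [set g (x + v) | v in [set v | (v <= V)%MS]].

Section Quotient.
Variables (m : nat) (V : 'M[R]_(m, d)).
Hypothesis gV : forall v, (v <= V)%MS -> 0 <= g v.

Lemma quotient_fun_has_inf x :
  has_inf [set g (x + v) | v in [set v | (v <= V)%MS]].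
Proof.
split; first by exists (g (x + 0)), 0 => //; exact: sub0mx.
exists (- g (- x)) => _ [v /= vV <-].
have [gD _] := g_sublin; have := gD (x + v) (- x).
rewrite addrAC subrr add0r; have := gV vV; lra.
Qed.

Lemma quotient_fun_le x v : (v <= V)%MS -> quotient_fun V x <= g (x + v).
Proof.
by move=> vV; apply: ge_inf; [have [] := quotient_fun_has_inf x|exists v].
Qed.

Lemma le_quotient_fun x c :
  (forall v, (v <= V)%MS -> c <= g (x + v)) -> c <= quotient_fun V x.
Proof.
move=> h; apply: lb_le_inf; first by have [] := quotient_fun_has_inf x.
by move=> _ [v /= vV <-]; exact: h.
Qed.

Lemma quotient_fun_lt x c : quotient_fun V x < c ->
  exists2 v, (v <= V)%MS & g (x + v) < c.
Proof.
rewrite -subr_gt0 => xc.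
have [_ [v /= vV <-] h] := inf_adherent xc (quotient_fun_has_inf x).
by exists v => //; apply: lt_le_trans h _; rewrite -/(quotient_fun V x) addrC subrK.
Qed.

Lemma quotient_fun_sublinear : sublinear (quotient_fun V).
Proof.
have [gD gZ] := g_sublin.
have homo t x : 0 < t -> quotient_fun V (t *: x) <= t * quotient_fun V x.
  move=> t0; rewrite mulrC -ler_pdivrMr//; apply: le_quotient_fun => v vV.
  rewrite ler_pdivrMr// mulrC -gZ ?(ltW t0)// scalerDr; apply: quotient_fun_le.
  by rewrite scalemx_sub.
split=> [x y|t x].
  rewrite -lerBlDr; apply: le_quotient_fun => v vV.
  rewrite lerBlDr -lerBlDl; apply: le_quotient_fun => u uV.
  rewrite lerBlDl; apply: le_trans (gD _ _).
  by rewrite addrACA; apply: quotient_fun_le; rewrite addmx_sub.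
rewrite le_eqVlt => /predU1P[<-|t0].
  rewrite mul0r scale0r; apply/eqP; rewrite eq_le; apply/andP; split.
    by rewrite -sublinear0 -{2}[0]addr0; apply: quotient_fun_le; exact: sub0mx.
  by apply: le_quotient_fun => v; rewrite add0r; exact: gV.
apply/eqP; rewrite eq_le homo//=.
rewrite -ler_pdivlMl//; apply: le_trans (homo _ _ _); last by rewrite invr_gt0.
by rewrite scalerA mulVf ?gt_eqF// scale1r.
Qed.
End Quotient.
End Sublinear.

Lemma cone_unit_vectors (R : realType) (d : nat) :
  exists2 S : set 'rV[int]_d, finite_set S &
    forall x : 'rV[R]_d, cone S x (d%:R * `|x|).
Proof.
exists (range (fun i : 'I_d => delta_mx 0 i) `|` range (fun i : 'I_d => - delta_mx 0 i)).
  by rewrite finite_setU; split; apply: finite_image; exact: finite_finset.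
move=> x; rewrite {1}(row_sum_delta x) mulr_natl -[X in _ *+ X]card_ord -sumr_const.
apply: cone_sum => i; apply: cone_weaken (coord_le_norm x i).
have dE : delta_mx 0 i = int_vec R (delta_mx 0 i).
  by apply/rowP => j; rewrite !mxE; case: (_ && _).
have [x0|/ltW x0] := leP 0 (x 0 i).
  by rewrite dE ger0_norm//; apply: coneZ_gen => //; left; exists i.
rewrite ler0_norm// -[_ *: _]opprK -scaleNr -scalerN dE.
rewrite -int_vecN.
by apply: coneZ_gen; [rewrite oppr_ge0|right; exists i].
Qed.

(** * Generation near one direction *)

(** The linear bound on the weight is part of the induction hypothesis: it bounds
    the corrections made in [locally_generated_mod]. *)
Definition finitely_generated (R : realType) (d : nat) (g : 'rV[R]_d -> R) :=
  exists S : set 'rV[int]_d, exists C : R,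
  [/\ finite_set S, S `<=` cut_vectors g, 0 <= C &
      forall z, cut_vectors g z -> cone S (int_vec R z) (C * `|int_vec R z|)].

(** Generation near the direction w, up to a remainder z' that is a cut vector at
    most half as long. *)
Definition locally_generated (R : realType) (d : nat) (g : 'rV[R]_d -> R)
    (w : 'rV[R]_d) :=
  exists S : set 'rV[int]_d, exists C e N : R,
  [/\ finite_set S, S `<=` cut_vectors g, 0 <= C, 0 < e &
      forall z, cut_vectors g z -> N <= `|int_vec R z| ->
      `|int_vec R z - `|int_vec R z| *: w| <= e * `|int_vec R z| ->
      exists z', [/\ cut_vectors g z', `|int_vec R z'| <= `|int_vec R z| / 2 &
        cone S (int_vec R z - int_vec R z') (C * `|int_vec R z|)]].

Lemma finite_set_bounded (R : realType) (T : choiceType) (A : set T) (f : T -> R) :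
  finite_set A -> exists2 B, 0 <= B & forall c, A c -> f c <= B.
Proof.
move=> /finite_seqP[F ->]; exists (\sum_(c <- F) `|f c|); first by rewrite sumr_ge0.
move=> c cF; rewrite (le_trans (ler_norm _))//.
by rewrite (big_rem c)//= lerDl sumr_ge0.
Qed.

Section Local.
Variables (R : realType) (d : nat) (g : 'rV[R]_d -> R) (w : 'rV[R]_d).
Hypothesis g_sublin : sublinear g.

Lemma locally_generated_pos : 0 < g w -> locally_generated g w.
Proof.
move=> gw; have [gD gZ] := g_sublin.
have [M M_gt0 gM] := sublinear_bounded g_sublin.
exists set0, 0, (g w / (2 * M)), (2 / g w); split=> //.
  by rewrite divr_gt0// mulr_gt0.
move=> z; rewrite /cut_vectors /= => gz; rewrite ler_pdivrMr// => zN zw; exfalso.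
set r := `|int_vec R z| in zN zw.
have := gD (int_vec R z) (r *: w - int_vec R z).
rewrite addrC subrK gZ ?normr_ge0// => h1.
have := gM (r *: w - int_vec R z); rewrite distrC => h2.
have := ler_wpM2l (ltW M_gt0) zw.
have -> : M * (g w / (2 * M) * r) = r * g w / 2 by field; rewrite gt_eqF.
lra.
Qed.

Lemma cut_vectors_near : g w <= 0 ->
  exists2 e, 0 < e & near_ray w e `<=` cut_vectors g.
Proof.
move=> gw; have [gD gZ] := g_sublin.
have [M M_gt0 gM] := sublinear_bounded g_sublin.
exists M^-1 => [|z [t]]; first by rewrite invr_gt0.
rewrite invrK => Mt zt; rewrite /cut_vectors /=.
rewrite -[int_vec R z](subrK (t *: w)); apply: le_lt_trans (gD _ _) _.
have t_ge0 : 0 <= t by apply: le_trans Mt; exact: ltW.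
have tw : g (t *: w) <= 0 by rewrite gZ// mulr_ge0_le0.
apply: le_lt_trans (lerD (gM _) tw) _.
by rewrite addr0 mulrC -ltr_pdivlMr// div1r.
Qed.

Variables (m : nat) (V : 'M[R]_(m, d)).
Hypotheses (spanV : ray_span w V) (gw : g w <= 0).

(** Here z - Z is again a cut vector for each integer vector Z of V, so taking Z
    close to |z| w leaves a short remainder. *)
Lemma locally_generated_lineal :
  (forall v, (v <= V)%MS -> g v <= 0) -> locally_generated g w.
Proof.
move=> gV; have [gD gZ] := g_sublin.
have [e1 e1_gt0 cut_near] := cut_vectors_near gw.
have [S [dl [C [finS Snear dl_gt0 C_ge0 SC]]]] := ray_span_interior spanV e1_gt0.
pose eta := Num.min dl 4^-1.
have eta_gt0 : 0 < eta by rewrite lt_min dl_gt0 invr_gt0/=.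
have [N N_gt0 mult] := ray_span_multiples spanV eta_gt0.
exists S, C, eta, N; split=> // [z /Snear/cut_near//|z gz zN zw].
have [Z ZV Zw] := mult _ zN.
have z_ge0 := normr_ge0 (int_vec R z).
have eta_dl : eta * `|int_vec R z| <= dl * `|int_vec R z|.
  by rewrite ler_wpM2r// ge_min lexx.
have eta_4 : eta * `|int_vec R z| <= 4^-1 * `|int_vec R z|.
  by rewrite ler_wpM2r// ge_min lexx orbT.
exists (z - Z); split.
- rewrite /cut_vectors /= int_vecB; apply: le_lt_trans (gD _ _) _.
  have : g (- int_vec R Z) <= 0 by apply: gV; rewrite eqmx_opp.
  by move: gz; rewrite /cut_vectors /=; lra.
- have -> : int_vec R (z - Z) = (int_vec R z - `|int_vec R z| *: w)
      - (int_vec R Z - `|int_vec R z| *: w).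
    by rewrite int_vecB opprB addrA subrK.
  by rewrite (le_trans (ler_normB _ _))//; lra.
- rewrite int_vecB opprB addrC subrK; apply: SC => //.
  exact: le_trans Zw _.
Qed.

(** T need only generate modulo V, and its elements need only become cut vectors
    after adding an integer vector of V.  For z = Z + a, lifting the
    generators in a combination for a adds some v of V of size O(|a|) to a;
    the compensating vector Z - v is still in the cone around w, because |a| is
    small relative to |z|. *)
Lemma locally_generated_mod (T : set 'rV[int]_d) (C2 : R) :
  finite_set T -> 0 <= C2 ->
  (forall c, T c -> exists2 z, (int_vec R z <= V)%MS & cut_vectors g (c + z)) ->
  (forall z Z, cut_vectors g z -> (int_vec R Z <= V)%MS ->
     cone T (int_vec R (z - Z)) (C2 * `|int_vec R (z - Z)|)) ->
  locally_generated g w.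
Proof.
move=> finT C2_ge0 liftT genT.
have [e1 e1_gt0 cut_near] := cut_vectors_near gw.
have [S1 [dl [C1 [finS1 S1near dl_gt0 C1_ge0 S1C]]]] := ray_span_interior spanV e1_gt0.
have [f fP] : {f : 'rV[int]_d -> 'rV[int]_d &
    forall c, T c -> (int_vec R (f c) <= V)%MS /\ cut_vectors g (c + f c)}.
  apply: (@choice _ _ (fun c z => T c -> (int_vec R z <= V)%MS /\ cut_vectors g (c + z))).
  move=> c; have [/liftT[z zV cz]|] := pselect (T c); first by exists z.
  by exists 0.
have [B B_ge0 fB] := finite_set_bounded (fun c => `|int_vec R (f c)|) finT.
pose S2 := [set c + f c | c in T].
(* With |Z - r w| <= eta r and |a| <= 2 eta r, where r = |z|, this is the value for
   which the bound eta r + B C2 |a| on |Z - v - r w| becomes dl r. *)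
pose eta := dl / (1 + 2 * B * C2).
have den_gt0 : 0 < 1 + 2 * B * C2 by rewrite ltr_pwDl// !mulr_ge0.
have eta_gt0 : 0 < eta by rewrite divr_gt0.
have etaE : eta + B * (C2 * (2 * eta)) = dl.
  by rewrite /eta; field; rewrite gt_eqF.
have [N N_gt0 mult] := ray_span_multiples spanV eta_gt0.
exists (S1 `|` S2), (C2 * (2 * eta) + C1), eta, N; split.
- by rewrite finite_setU; split => //; exact: finite_image.
- move=> z [/S1near/cut_near//|[c Tc <-]].
  by have [] := fP _ Tc.
- by rewrite addr_ge0// mulr_ge0// mulr_ge0// ltW.
- by [].
move=> z gz zN zw; have [Z ZV Zw] := mult _ zN.
set r := `|int_vec R z| in zN zw Zw *.
have r_ge0 : 0 <= r := normr_ge0 _.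
have zZ : `|int_vec R (z - Z)| <= 2 * eta * r.
  have -> : int_vec R (z - Z) = (int_vec R z - r *: w) - (int_vec R Z - r *: w).
    by rewrite int_vecB opprB addrA subrK.
  by rewrite (le_trans (ler_normB _ _))//; lra.
have TS2 c : T c -> exists z0, [/\ (int_vec R z0 <= V)%MS,
    `|int_vec R z0| <= B & S2 (c + z0)].
  by move=> Tc; have [h1 _] := fP _ Tc; exists (f c); split; [|exact: fB|exists c].
have [v [vV vB S2v]] := cone_shift B_ge0 TS2 (genT z Z gz ZV).
have C2zZ : C2 * `|int_vec R (z - Z)| <= C2 * (2 * eta) * r.
  by rewrite -mulrA ler_wpM2l.
have S1Zv : cone S1 (int_vec R Z - v) (C1 * r).
  apply: S1C => //; first by rewrite addmx_sub// eqmx_opp.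
  rewrite addrAC (le_trans (ler_normB _ _))// -etaE mulrDl lerD//.
  by rewrite (le_trans vB)// -mulrA ler_wpM2l.
exists 0; split.
- by rewrite /cut_vectors /= int_vec0 sublinear0.
- by rewrite int_vec0 normr0 divr_ge0.
have -> : int_vec R z - int_vec R 0 = (int_vec R (z - Z) + v) + (int_vec R Z - v).
  by rewrite int_vec0 int_vecB subr0 addrACA subrK subrr addr0.
rewrite mulrDl; apply: coneD.
  by apply: cone_weaken C2zZ; apply: cone_sub S2v => c; right.
by apply: cone_sub S1Zv => c; left.
Qed.

End Local.

(** U is a subspace on which g is known to be at most 0.  Unless V lies in U,
    passing to the quotient by V enlarges U to U + V. *)
Lemma locally_generated_step (R : realType) (d : nat) (g : 'rV[R]_d -> R)
    (U : 'M[R]_d) (w : 'rV[R]_d) :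
  sublinear g -> (forall u, (u <= U)%MS -> g u <= 0) ->
  (forall (phi : 'rV[R]_d -> R) (U' : 'M[R]_d), sublinear phi ->
    (\rank U < \rank U')%N -> (forall u, (u <= U')%MS -> phi u <= 0) ->
    finitely_generated phi) ->
  locally_generated g w.
Proof.
move=> g_sublin gU IH; have [gD gZ] := g_sublin.
have [gw|gw] := ltP 0 (g w); first exact: locally_generated_pos.
have [m [V spanV]] := ray_span_exists w.
have [VU|VU] := boolP (V <= U)%MS.
  apply: (locally_generated_lineal g_sublin spanV gw) => v vV.
  by apply: gU; exact: submx_trans VU.
have [[v vV gv]|gV] := pselect (exists2 v, (v <= V)%MS & g v < 0).
  have [T finT genT] := cone_unit_vectors R d.
  apply: (locally_generated_mod g_sublin spanV gw finT (ler0n R d)) => // c _.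
  (* A large multiple of v pushes g below 1 from any starting point. *)
  pose k := `|g (int_vec R c)| / - g v.
  have k_ge0 : 0 <= k by rewrite divr_ge0// oppr_ge0 ltW.
  have kv : (k *: v <= V)%MS by rewrite scalemx_sub.
  have gckv : g (int_vec R c + k *: v) < 1.
    apply: le_lt_trans (gD _ _) _; rewrite gZ//.
    have -> : k * g v = - `|g (int_vec R c)|.
      by rewrite /k; field; rewrite lt_eqF.
    have := ler_norm (g (int_vec R c)); lra.
  have [z zV gz] := sublinear_lift g_sublin spanV gw kv gckv.
  by exists z => //; rewrite /cut_vectors /= int_vecD.
have gV_ge0 v : (v <= V)%MS -> 0 <= g v.
  by move=> vV; rewrite leNgt; apply/negP => gv; apply: gV; exists v.
have [|u|S [C [finS Sphi C_ge0 genS]]] :=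
    IH (quotient_fun g V) (U + V)%MS (quotient_fun_sublinear g_sublin gV_ge0).
- by apply: rank_ltmx; rewrite ltmxE addsmxSl /= addsmx_sub submx_refl (negbTE VU).
- move=> /sub_addsmxP[[D1 D2] /= ->].
  apply: le_trans (@quotient_fun_le _ _ _ g_sublin _ _ gV_ge0 _ (- (D2 *m V)) _) _.
    by rewrite eqmx_opp submxMl.
  by rewrite addrK gU// submxMl.
apply: (locally_generated_mod g_sublin spanV gw finS C_ge0) => [c /Sphi|z Z gz ZV].
  move=> /(quotient_fun_lt g_sublin gV_ge0)[v vV gcv].
  have [z zV gz] := sublinear_lift g_sublin spanV gw vV gcv.
  by exists z => //; rewrite /cut_vectors /= int_vecD.
apply: genS; rewrite /cut_vectors /=.
apply: le_lt_trans (@quotient_fun_le _ _ _ g_sublin _ _ gV_ge0 _ _ ZV) _.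
by rewrite int_vecB subrK.
Qed.

(** * Finite generation of the cut vectors *)

Lemma finite_int_box (R : realType) (d : nat) (N : R) :
  finite_set [set z : 'rV[int]_d | `|int_vec R z| <= N].
Proof.
pose k := (Num.truncn N).+1.
apply: (@sub_finite_set _ _ (range (fun f : {ffun 'I_d -> 'I_(k + k).+1} =>
    \row_i ((f i : nat)%:Z - k%:Z)))); last first.
  by apply: finite_image; exact: finite_finset.
move=> z /= zN.
have zk i : `|z 0 i| <= k%:Z.
  rewrite -(ler_int R) intr_norm; have := coord_le_norm (int_vec R z) i.
  by rewrite mxE => /le_trans; apply; apply: (le_trans zN); apply: ltW; exact: truncnS_gt.
exists [ffun i => inord (absz (z 0 i + k%:Z))] => //.
apply/rowP => i; rewrite mxE ffunE.
have zk_ge0 : 0 <= z 0 i + k%:Z by have := zk i; rewrite ler_norml; lia.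
rewrite inordK ?gez0_abs ?addrK//.
have := zk i; rewrite ler_norml; lia.
Qed.

(** Finitely many balls cover the sphere; the finitely many short cut vectors are
    added to the generators, and the others are handled by repeated halving.  If
    |z| is at most N 2^k, then k halvings suffice.  The weight constant
    1 + 2 C satisfies C + (1 + 2 C) / 2 <= 1 + 2 C, so it survives the
    recursion. *)
Lemma finitely_generated_of_local (R : realType) (d : nat) (g : 'rV[R]_d -> R) :
  (forall w, `|w| = 1 -> locally_generated g w) -> finitely_generated g.
Proof.
move=> loc.
pose good (A : set 'rV[R]_d) := exists S : set 'rV[int]_d, exists C N : R,
  [/\ finite_set S, S `<=` cut_vectors g, 0 <= C &
      forall z, cut_vectors g z -> N <= `|int_vec R z| ->
      A (`|int_vec R z|^-1 *: int_vec R z) ->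
      exists z', [/\ cut_vectors g z', `|int_vec R z'| <= `|int_vec R z| / 2 &
        cone S (int_vec R z - int_vec R z') (C * `|int_vec R z|)]].
have good_ball w : `|w| = 1 -> exists2 e, 0 < e & good (ball w e).
  move=> /loc[S [C [e [N [finS Scut C_ge0 e_gt0 H]]]]]; exists e => //.
  exists S, C, N; split=> // z gz zN; rewrite -ball_normE /= => zw.
  apply: H => //; have [z0|z0] := eqVneq `|int_vec R z| 0.
    by rewrite z0 scale0r subr0 z0 mulr0.
  have -> : int_vec R z - `|int_vec R z| *: w =
      `|int_vec R z| *: (`|int_vec R z|^-1 *: int_vec R z - w).
    by rewrite scalerBr scalerA divff// scale1r.
  by rewrite normrZ normr_id mulrC ler_wpM2r// distrC ltW.
have [ef efP] : {ef : 'rV[R]_d -> R &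
    forall w, `|w| = 1 -> 0 < ef w /\ good (ball w (ef w))}.
  apply: (@choice _ _ (fun w e => `|w| = 1 -> 0 < e /\ good (ball w e))) => w.
  have [/good_ball[e e0 ge]|] := pselect (`|w| = 1); first by exists e.
  by exists 0.
have sphere_compact : compact [set w : 'rV[R]_d | `|w| = 1].
  apply: bounded_closed_compact.
    by exists 1; split; [exact: real1|move=> M M1 w /= ->; exact: ltW].
  apply: (@closed_comp _ _ (fun w : 'rV[R]_d => `|w|) [set 1]).
    by move=> w _; exact: norm_continuous.
  exact: closed_eq.
move: sphere_compact; rewrite compact_cover.
move=> /(_ _ [set w | `|w| = 1] (fun w => ball w (ef w))).
case=> [w _|w w1|F FS Fcov]; first exact: ball_open.
  by exists w => //; apply: ballxx; have [] := efP _ w1.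
have good_cover (s : seq 'rV[R]_d) : (forall w, w \in s -> `|w| = 1) ->
    good (cover [set` s] (fun w => ball w (ef w))).
  elim: s => [_|w s IH ws].
    by exists set0, 0, 0; split=> // z _ _ [].
  have [_ [S1 [C1 [N1 [finS1 S1cut C1_ge0 H1]]]]] := efP w (ws w (mem_head _ _)).
  have [|S2 [C2 [N2 [finS2 S2cut C2_ge0 H2]]]] := IH.
    by move=> v vs; apply: ws; rewrite inE vs orbT.
  exists (S1 `|` S2), (C1 + C2), (Num.max N1 N2); split.
  - by rewrite finite_setU.
  - by move=> c [/S1cut|/S2cut].
  - by rewrite addr_ge0.
  move=> z gz; rewrite ge_max => /andP[zN1 zN2] [v /=].
  rewrite inE => /predU1P[->|vs] zv.
    have [z' [gz' z'z S1z']] := H1 z gz zN1 zv; exists z'; split=> //.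
    apply: (@cone_weaken _ _ _ _ (C1 * `|int_vec R z|)).
      by apply: cone_sub S1z' => c; left.
    by rewrite ler_wpM2r// lerDl.
  have [|z' [gz' z'z S2z']] := H2 z gz zN2; first by exists v.
  exists z'; split=> //; apply: (@cone_weaken _ _ _ _ (C2 * `|int_vec R z|)).
    by apply: cone_sub S2z' => c; right.
  by rewrite ler_wpM2r// lerDr.
have /finite_seqP[s Fs] := finite_fset F.
have [|S [C [N0 [finS Scut C_ge0 H]]]] := good_cover s.
  move=> w ws; have /FS/set_mem : [set` F] w by rewrite Fs.
  by [].
rewrite Fs in Fcov.
pose N := Num.max N0 1.
pose S0 := cut_vectors g `&` [set z | `|int_vec R z| <= N].
have small z : cut_vectors g z -> `|int_vec R z| <= N ->
    cone (S `|` S0) (int_vec R z) ((1 + 2 * C) * `|int_vec R z|).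
  move=> gz zN; have [->|z0] := eqVneq z 0.
    by rewrite int_vec0; apply: Cone0; rewrite normr0 mulr0.
  apply: (@cone_weaken _ _ _ _ 1); first by apply: cone_gen; right.
  have := int_vec_norm_ge1 R z0; move=> z1; apply: (le_trans z1).
  by rewrite ler_peMl// lerDl mulr_ge0.
exists (S `|` S0), (1 + 2 * C); split.
- by rewrite finite_setU; split=> //; apply: finite_setIr; exact: finite_int_box.
- by move=> z [/Scut|[]].
- by rewrite addr_ge0// mulr_ge0.
move=> z gz.
have [k zk] : exists k, `|int_vec R z| <= N * 2 ^+ k.
  exists (Num.truncn `|int_vec R z|).+1; apply: ltW; apply: lt_le_trans (truncnS_gt _) _.
  rewrite -[leLHS]mul1r ler_pM//; first by rewrite le_max lexx orbT.
  by rewrite -natrX ler_nat ltnW// ltn_expl.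
elim: k z gz zk => [|k IH] z gz zk; first by apply: small => //; rewrite mulr1 in zk.
have [|zN] := leP `|int_vec R z| N; first exact: small.
have z_gt0 : 0 < `|int_vec R z|.
  by apply: lt_trans zN; rewrite lt_max ltr01 orbT.
have [||z' [gz' z'z Sz']] := H z gz.
- by apply: le_trans (ltW zN); rewrite le_max lexx.
- by apply: Fcov; rewrite /= normrZ normfV normr_id mulVf// gt_eqF.
have /(IH _ gz') Sz'2 : `|int_vec R z'| <= N * 2 ^+ k.
  by apply: (le_trans z'z); rewrite ler_pdivrMr// -mulrA -exprSr.
rewrite -[int_vec R z](subrK (int_vec R z')).
apply: (@cone_weaken _ _ _ _ (C * `|int_vec R z| + (1 + 2 * C) * `|int_vec R z'|)).
  by apply: coneD Sz'2; apply: cone_sub Sz' => c; left.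
rewrite subrK.
have := ler_wpM2l (_ : 0 <= 1 + 2 * C) z'z; rewrite addr_ge0// ?mulr_ge0// => /(_ isT).
have := ltW z_gt0; lra.
Qed.

(** Induction on the codimension of a subspace on which g is at most 0. *)
Theorem cut_vectors_finitely_generated (R : realType) (d : nat)
    (g : 'rV[R]_d -> R) :
  sublinear g -> finitely_generated g.
Proof.
move=> g_sublin.
suff H k (U : 'M[R]_d) : forall h, sublinear h -> (d - \rank U <= k)%N ->
    (forall u, (u <= U)%MS -> h u <= 0) -> finitely_generated h.
  apply: (H d 0 g g_sublin); first by rewrite leq_subr.
  by move=> u; rewrite submx0 => /eqP ->; rewrite sublinear0.
elim: k U => [|k IH] U h h_sublin rkU hU;
  apply: finitely_generated_of_local => w _;
  apply: (@locally_generated_step R d h U w h_sublin hU) => phi U' phi_sublin UU' phiU'.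
  by have := rank_leq_col U'; lia.
by apply: (IH U') => //; lia.
Qed.

(** * Support functions and the Chvatal-Gomory closure *)

Lemma dotpDl (R : realType) (d : nat) (x y v : 'rV[R]_d) :
  dotp (x + y) v = dotp x v + dotp y v.
Proof. by rewrite /dotp -big_split; apply: eq_bigr => i _; rewrite mxE mulrDl. Qed.

Lemma dotpZl (R : realType) (d : nat) (t : R) (x v : 'rV[R]_d) :
  dotp (t *: x) v = t * dotp x v.
Proof. by rewrite /dotp mulr_sumr; apply: eq_bigr => i _; rewrite mxE mulrA. Qed.

Lemma dotp0l (R : realType) (d : nat) (v : 'rV[R]_d) : dotp 0 v = 0.
Proof. by rewrite /dotp big1// => i _; rewrite mxE mul0r. Qed.

Lemma dotp_row_mx (R : realType) (m d : nat) (a c : 'rV[R]_m) (b e : 'rV[R]_d) :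
  dotp (row_mx a b) (row_mx c e) = dotp a c + dotp b e.
Proof.
rewrite /dotp big_split_ord; congr (_ + _); apply: eq_bigr => i _;
  by rewrite ?row_mxEl ?row_mxEr.
Qed.

Lemma dotp_le_norm (R : realType) (d : nat) (x y : 'rV[R]_d) :
  dotp x y <= d%:R * (`|x| * `|y|).
Proof.
rewrite mulr_natl -[X in _ *+ X]card_ord -sumr_const; apply: ler_sum => i _.
by rewrite (le_trans (ler_norm _))// normrM ler_pM// coord_le_norm.
Qed.

Lemma cone_dotp_le0 (R : realType) (d : nat) (S : set 'rV[int]_d)
    (x y : 'rV[R]_d) (s : R) :
  (forall c, S c -> dotp (int_vec R c) y <= 0) -> cone S x s -> dotp x y <= 0.
Proof.
move=> Sy; elim=> [t _|c l {}x {}s Sc l0 _ IH].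
  by rewrite dotp0l.
by rewrite dotpDl dotpZl -[0]addr0 lerD// mulr_ge0_le0// Sy.
Qed.

(** Real-valued counterpart of [support_fun], which it represents for bounded
    nonempty sets ([support_funE]). *)
Definition support (R : realType) (d : nat) (K : set 'rV[R]_d) (a : 'rV[R]_d) : R :=
  sup [set dotp a x | x in K].

Section Support.
Variables (R : realType) (d : nat) (K : set 'rV[R]_d).
Hypotheses (K_nonempty : K !=set0) (K_bounded : bounded_set K).

Lemma support_has_sup a : has_sup [set dotp a x | x in K].
Proof.
have [x Kx] := K_nonempty; split; first by exists (dotp a x), x.
have [M [_ /(_ (M + 1))]] := K_bounded; rewrite ltrDl ltr01 => /(_ isT) KM.
exists (d%:R * (`|a| * (M + 1))) => _ [{Kx}x Kx <-].
rewrite (le_trans (dotp_le_norm _ _))// ler_wpM2l// ler_wpM2l//.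
exact: (KM _ Kx).
Qed.

Lemma dotp_le_support a x : K x -> dotp a x <= support K a.
Proof. by move=> Kx; apply: sup_upper_bound; [exact: support_has_sup|exists x]. Qed.

Lemma support_le a c : (forall x, K x -> dotp a x <= c) -> support K a <= c.
Proof.
move=> Kc; apply: ge_sup; first by have [] := support_has_sup a.
by move=> _ [x Kx <-]; exact: Kc.
Qed.

Lemma support_sublinear : sublinear (support K).
Proof.
split=> [a b|t a t_ge0].
  by apply: support_le => x Kx; rewrite dotpDl lerD// dotp_le_support.
have [x0 Kx0] := K_nonempty.
move: t_ge0; rewrite le_eqVlt => /predU1P[<-|t_gt0].
  rewrite mul0r scale0r; apply/eqP; rewrite eq_le.
  rewrite support_le => [|x _]; last by rewrite dotp0l.
  by rewrite -(dotp0l x0) dotp_le_support.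
apply/eqP; rewrite eq_le; apply/andP; split.
  by apply: support_le => x Kx; rewrite dotpZl ler_wpM2l ?(ltW t_gt0)// dotp_le_support.
rewrite -ler_pdivlMl//; apply: support_le => x Kx.
by rewrite ler_pdivlMl// -dotpZl dotp_le_support.
Qed.

Lemma support_funE a : support_fun K a = (support K a)%:E.
Proof.
have [? ?] := support_has_sup a.
by rewrite /support_fun -ereal_sup_EFin// image_comp.
Qed.

Lemma CG_cutsP (S : set 'rV[int]_d) x :
  CG_cuts K S x <-> forall a, S a ->
    dotp (int_vec R a) x <= (Num.floor (support K (int_vec R a)))%:~R.
Proof.
by split=> H a Sa; have := H a Sa; rewrite /= support_funE lee_fin.
Qed.

End Support.

Lemma rational_polyhedron_CG_cuts (R : realType) (n : nat) (K : set 'rV[R]_n)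
    (S : set 'rV[int]_n) :
  K !=set0 -> bounded_set K -> finite_set S -> rational_polyhedron (CG_cuts K S).
Proof.
move=> K0 Kb /finite_seqP[s ->].
exists (size s), (\matrix_(i < size s) map_mx intr (nth 0 s i)),
  (\row_i (Num.floor (support K (int_vec R (nth 0 s i))))%:~R).
have rowE i : map_mx ratr (row i (\matrix_(i < size s) map_mx intr (nth 0 s i)))
    = int_vec R (nth 0 s i).
  by apply/rowP => j; rewrite rowK !mxE ratr_int.
apply/seteqP; split=> x.
  move=> /CG_cutsP - /(_ K0 Kb) H i; rewrite rowE mxE ratr_int; apply: H.
  exact: mem_nth.
move=> H; apply/CG_cutsP => // a /= /(nthP 0)[i si <-].
by have := H (Ordinal si); rewrite rowE mxE ratr_int.
Qed.

(** The homogenised function g(b, a) = h(a) - b is itself a support function,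
    namely that of the set of all (-1, x) with x in K. *)
Lemma CG_closure_finitely_generated (R : realType) (n : nat) (K : set 'rV[R]_n) :
  K !=set0 -> bounded_set K ->
  exists2 S : set 'rV[int]_n, finite_set S & CG_closure K = CG_cuts K S.
Proof.
move=> K0 Kb.
pose hom (x : 'rV[R]_n) : 'rV[R]_(1 + n) := row_mx (const_mx (-1)) x.
have dot_hom b a x : dotp (int_vec R (row_mx (const_mx b) a)) (hom x) =
    dotp (int_vec R a) x - b%:~R.
  rewrite /int_vec map_row_mx dotp_row_mx addrC; congr (_ + _).
  by rewrite /dotp big_ord1 !mxE mulrN1.
have homK0 : hom @` K !=set0 by have [x Kx] := K0; exists (hom x), x.
have homKb : bounded_set (hom @` K).
  have [M [_ /(_ (`|M| + 1))]] := Kb.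
  rewrite (le_lt_trans (ler_norm M)) ?ltrDl// => /(_ isT) KM.
  exists (`|M| + 1); split; first exact: num_real.
  move=> M' MM' _ [x Kx <-] /=; apply: le_trans (ltW MM').
  apply: norm_le_coord => [|i]; first by rewrite addr_ge0.
  case: (split_ordP i) => j ->; rewrite /hom ?row_mxEl ?row_mxEr.
    by rewrite mxE normrN1 lerDr.
  exact: le_trans (coord_le_norm _ _) (KM _ Kx).
have [S [C [finS Scut _ genS]]] :=
  cut_vectors_finitely_generated (support_sublinear homK0 homKb).
exists (rsubmx @` S); first exact: finite_image.
apply/seteqP; split=> x.
  by move=> /CG_cutsP - /(_ K0 Kb) H; apply/CG_cutsP => // a _; exact: H.
move=> /CG_cutsP - /(_ K0 Kb) H; apply/CG_cutsP => // a _.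
set f := Num.floor _; have /andP[_ hf] := floor_itv (support K (int_vec R a)).
have az : cut_vectors (support (hom @` K)) (row_mx (const_mx f) a).
  apply: (@le_lt_trans _ _ (support K (int_vec R a) - f%:~R)).
    apply: support_le => // _ [y Ky <-]; rewrite dot_hom lerB//.
    exact: dotp_le_support.
  by rewrite ltrBlDl -intrD1.
rewrite -subr_le0 -dot_hom; apply: cone_dotp_le0 (genS _ az) => c Sc.
(* The generator c = (c0, a') has floor (h a') <= c0, as h a' - c0 < 1 and c0 is
   an integer. *)
have cE : c = row_mx (const_mx (c 0 (lshift n 0))) (rsubmx c).
  rewrite -{1}[c]hsubmxK; congr row_mx; apply/rowP => i.
  by rewrite !mxE ord1.
rewrite cE dot_hom subr_le0; apply: le_trans (H _ (imageP _ Sc)) _.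
rewrite ler_int -ltzD1 floor_lt_int intrD1 -ltrBlDl.
apply: le_lt_trans (Scut _ Sc : support (hom @` K) (int_vec R c) < 1).
rewrite lerBlDr; apply: support_le => // y Ky.
rewrite -lerBlDr -dot_hom -cE; exact: dotp_le_support.
Qed.

Theorem theorem2p1 (R : realType) (n : nat) (K : set 'rV[R]_n)
    (K_nonempty : K !=set0) (K_compact : compact K) (K_convex : convex_set K) :
  (exists S : set 'rV[int]_n,
      finite_set S /\ CG_closure K = CG_cuts K S) /\
  rational_polyhedron (CG_closure K).
Proof.
have K_bounded := compact_bounded K_compact.
have [S finS KS] := CG_closure_finitely_generated K_nonempty K_bounded.
split; first by exists S.
by rewrite KS; exact: rational_polyhedron_CG_cuts.
Qed.
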